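(* Let $\mathcal H\subseteq\mathcal Y^{\mathcal X}$ be a hypothesis class, let $\epsilon_0\in(0,\tfrac12)$ and $\delta_0\in(0,1)$, and assume that there exist a positive integer $k_0=k_0(\epsilon_0)$, an integer $m(\epsilon_0,\delta_0)$ and an algorithm such that for every $\mathcal H$-realizable distribution $\mathcal D$ over $\mathcal X\times\mathcal Y$, when given $S\sim\mathcal D^m$ with $m\ge m(\epsilon_0,\delta_0)$, it returns $\mu_S:\mathcal X\to\mathcal Y^{k_0}$ such that with probability at least $1-\delta_0$, $$\Pr_{(x,y)\sim\mathcal D}[y\in\mu_S(x)]\ge 1-\epsilon_0 .$$ Then there is a $k$-list PAC learning algorithm for $\mathcal H$ with the fixed list size $k=\left\lfloor\frac{k_0}{1-2\epsilon_0}\right\rfloor$.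
   Context: A distribution $\mathcal D$ over $\mathcal X\times\mathcal Y$ is $\mathcal H$-realizable if $\inf_{h\in\mathcal H}\Pr_{(x,y)\sim\mathcal D}[h(x)\neq y]=0$. For $\mu:\mathcal X\to\mathcal Y^k$, $y\in\mu(x)$ means $y$ is one of the $k$ entries of $\mu(x)$. An algorithm is a (possibly randomized) map from finite samples to outputs of the stated type. A $k$-list PAC learning algorithm for $\mathcal H$ is an algorithm for which there is a function $m(\epsilon,\delta)$ such that for every $\mathcal H$-realizable $\mathcal D$ and every $\epsilon,\delta>0$, given $S\sim\mathcal D^m$ with $m\ge m(\epsilon,\delta)$, it returns $\mu_S:\mathcal X\to\mathcal Y^k$ such that with probability at least $1-\delta$, $\Pr_{(x,y)\sim\mathcal D}[y\in\mu_S(x)]\ge1-\epsilon$. *)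

(* Defs.v *)
From HB Require Import structures.
From mathcomp Require Import all_boot all_order all_algebra.
From mathcomp Require Import all_classical all_reals all_analysis.

Set Implicit Arguments.
Unset Strict Implicit.
Unset Printing Implicit Defensive.

Import Order.TTheory GRing.Theory Num.Theory.

Local Open Scope classical_set_scope.
Local Open Scope ring_scope.

Section iid_sample.
Context d (Z : measurableType d) (R : realType).

Definition cons_sample n (p : Z * n.-tuple Z) : n.+1.-tuple Z :=
  [tuple of p.1 :: p.2].

Lemma measurable_cons_sample n : measurable_fun setT (@cons_sample n).
Proof. exact: (measurable_cons measurable_fst measurable_snd). Qed.

HB.instance Definition _ n :=
  isMeasurableFun.Build _ _ _ _ (@cons_sample n) (@measurable_cons_sample n).

(* [iid D n] is the n-fold product D^n, carried by n.-tuple Z. *)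
Fixpoint iid (D : probability Z R) (n : nat) : probability (n.-tuple Z) R :=
  match n with
  | 0 => @dirac _ (0.-tuple Z) [tuple] R
  | n'.+1 => distribution (D \x iid D n')%E (@cons_sample n')
  end.

End iid_sample.

Section list_learning.
Context (R : realType) (dX dY : measure_display).
Context (X : measurableType dX) (Y : measurableType dY).

(* A randomized algorithm is a map of the sample and of an internal random
   seed, drawn independently of the sample. The law of the seed may depend on
   the sample size. Joint measurability is what gives the success
   probabilities below a meaning, as the library evaluates measures on
   arbitrary sets but constrains them on measurable sets only. *)
Record list_algorithm (k : nat) := ListAlgorithm {
  seed_display : nat -> measure_display;
  seed : forall n, measurableType (seed_display n);
  seed_law : forall n, probability (seed n) R;
  output : forall n, n.-tuple (X * Y) -> seed n -> X -> k.-tuple Y;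
  measurable_output : forall n, measurable_fun setT
    (fun p : (n.-tuple (X * Y) * seed n) * X => output p.1.1 p.1.2 p.2)
}.

Arguments seed {k} A n : rename.
Arguments seed_law {k} A n : rename.
Arguments output {k} A {n} _ _ _ : rename.

Definition realizable (H : set (X -> Y)) (D : probability (X * Y)%type R) :=
  ereal_inf [set D [set z | h z.1 <> z.2] | h in H] = 0%E.

(* For the inner event, [output A w.1 w.2] is the list map returned on the
   sample [w.1] and the seed [w.2]. *)
Definition succeeds k (A : list_algorithm k) (D : probability (X * Y)%type R)
    (n : nat) (eps delta : R) :=
  ((1 - delta)%:E <= (iid D n \x seed_law A n)
     [set w | (1 - eps)%:E <=
              D [set z | z.2 \in output A w.1 w.2 z.1]])%E.

Definition list_PAC_learner k (H : set (X -> Y)) (A : list_algorithm k) :=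
  exists m : R -> R -> nat,
    forall D : probability (X * Y)%type R, realizable H D ->
    forall eps delta : R, 0 < eps -> 0 < delta ->
    forall n : nat, (m eps delta <= n)%N -> succeeds A D n eps delta.

End list_learning.

(* Main.v *)
(* The weak learner is boosted by a sample compression argument.

   Fix a sample of size n consistent with some h in H and a weight vector on it;
   the weighted empirical law is realizable, so some m0-tuple of sample points
   makes the weak learner succeed on that law with probability at least
   1 - delta0 over its seed. With n ^ 2 independent seeds, every one of the
   finitely many weight vectors 2 ^ (number of misses) met by the
   multiplicative-weights algorithm is served by some (m0-tuple, seed) pair, so T
   runs of the weak learner can be chosen such that each sample point is covered
   by a fraction at least 1 - 2 eps0 of the T lists. At most k0 / (1 - 2 eps0)
   labels of a point x can be that frequent, so they fit in a list of the
   required size.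

   The resulting list map depends on m0 T sample points only, the remaining ones
   being fresh test points; a union bound over the at most (n ^ m0 n ^ 2) ^ T
   choices of T runs gives generalization as soon as T log n is small
   compared with n. *)

Require Import Defs.
From HB Require Import structures.
From mathcomp Require Import all_boot all_order all_algebra.
From mathcomp Require Import all_classical all_reals all_analysis.
From mathcomp Require Import measurable_realfun.
From mathcomp Require Import ring lra.

Set Implicit Arguments.
Unset Strict Implicit.
Unset Printing Implicit Defensive.

Import Order.TTheory GRing.Theory Num.Theory.

Local Open Scope classical_set_scope.
Local Open Scope ring_scope.

(** * Combinatorics and numerical bounds *)

(** Multiplicative weights: a point missed too often would by itself outweigh the bound on the total
    weight. Weights are encoded by exponents in ['I_T.+1], so that only finitely many weight vectors
    have to be served and a union bound over them is possible. *)
Lemma boosting (R : realType) (n T : nat) (J : finType)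
    (cov : J -> 'I_n -> bool) (eps : R) : 0 <= eps ->
  (forall v : {ffun 'I_n -> 'I_T.+1}, exists j : J,
    \sum_(i | ~~ cov j i) 2 ^+ v i <= eps * \sum_i 2 ^+ v i) ->
  (forall m : nat, 2 * eps * T%:R < m%:R -> n%:R * (1 + eps) ^+ T < 2 ^+ m) ->
  exists f : {ffun 'I_T -> J}, forall i,
    (1 - 2 * eps) * T%:R <= (\sum_(t < T) cov (f t) i)%:R.
Proof.
move=> eps0 weak large.
(* Weighting each point by [2 ^+ misses], a run missing a fraction at most [eps]
   of the weight multiplies the total weight by at most [1 + eps]. *)
pose miss (s : seq J) i := count (fun j => ~~ cov j i) s.
have rounds t : (t <= T)%N -> exists2 s : seq J, size s = t &
    \sum_i 2 ^+ miss s i <= n%:R * (1 + eps) ^+ t :> R.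
  elim: t => [_|t IH tT].
    exists [::] => //.
    by rewrite sumr_const card_ord expr0 mulr1.
  have [s sz_s ws] := IH (ltnW tT).
  (* After [t] rounds a point has at most [t] misses, so [inord] truncates nothing. *)
  have [j wj] := weak [ffun i => inord (miss s i)].
  have vE i : [ffun i => inord (miss s i) : 'I_T.+1] i = miss s i :> nat.
    rewrite ffunE inordK // ltnS (leq_trans (count_size _ _)) // sz_s.
    exact: ltnW.
  exists (j :: s); first by rewrite /= sz_s.
  have -> : \sum_i 2 ^+ miss (j :: s) i =
      \sum_i 2 ^+ miss s i + \sum_(i | ~~ cov j i) 2 ^+ miss s i :> R.
    rewrite [X in _ + X]big_mkcond -big_split /=; apply: eq_bigr => i _.
    by rewrite /miss /=; case: (cov j i) => /=;
      rewrite ?add0n ?addr0 // add1n exprS; ring.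
  have wj' : \sum_(i | ~~ cov j i) 2 ^+ miss s i <=
             eps * \sum_i 2 ^+ miss s i :> R.
    move: wj; under eq_bigr do rewrite vE.
    by under [in X in _ <= X]eq_bigr do rewrite vE.
  rewrite exprS mulrCA (le_trans (lerD (lexx _) wj')) //.
  by rewrite -{1}[X in X + _]mul1r -mulrDl ler_wpM2l // addr_ge0.
have [s sz_s ws] := rounds T (leqnn T).
have sz : size s == T by rewrite sz_s.
exists [ffun t => tnth (Tuple sz) t] => i.
have hits : (\sum_(t < T) cov ([ffun t => tnth (Tuple sz) t] t) i + miss s i =
    T)%N.
  have -> : (\sum_(t < T) cov ([ffun t => tnth (Tuple sz) t] t) i =
      count (fun j => cov j i) s)%N.
    rewrite -sum1_count -[in RHS](_ : tval (Tuple sz) = s) // big_tuple.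
    rewrite [RHS]big_mkcond; apply: eq_bigr => t _.
    by rewrite ffunE; case: (cov _ _).
  by rewrite /miss count_predC sz_s.
(* The weight of [i] alone bounds the total from below, so [large] at [m = miss s i] would
   contradict [ws]. *)
have missT : (miss s i)%:R <= 2 * eps * T%:R.
  rewrite leNgt; apply/negP => /large; apply/negP; rewrite -leNgt.
  by rewrite (le_trans _ ws) // (bigD1 i) //= lerDl sumr_ge0.
have := congr1 (fun m => m%:R : R) hits; rewrite natrD; lra.
Qed.

(** A heavy label takes up at least [theta * T] of the [k0 * T] places in the lists. Labels are
    addressed by list and position, not by value: [q] then ranges over a finite type, as measurable
    selection requires. *)
Lemma heavy_labels (R : realType) (Y : eqType) (T k0 : nat) (theta : R)
    (L : 'I_T -> k0.-tuple Y) : 0 < theta -> (0 < T)%N -> (0 < k0)%N ->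
  exists q : {ffun 'I_(Num.truncn (k0%:R / theta)) -> 'I_T * 'I_k0},
    forall y, theta * T%:R <= (\sum_(t < T) (y \in L t))%:R ->
    exists l, y = tnth (L (q l).1) (q l).2.
Proof.
set k := Num.truncn _ => theta0 T0 k00.
pose entry (p : 'I_T * 'I_k0) := tnth (L p.1) p.2.
pose heavy y := theta * T%:R <= (\sum_(t < T) (y \in L t))%:R.
pose s := undup [seq y <- [seq entry p | p : 'I_T * 'I_k0] | heavy y].
(* Double counting of the incidences between heavy labels and lists. *)
have sz_s : (size s <= k)%N.
  rewrite truncn_ge_nat; last by rewrite divr_ge0 // ltW.
  rewrite ler_pdivlMr // -(ler_pM2r (_ : 0 < T%:R)) ?ltr0n // -mulrA.
  have : (\sum_(y <- s) \sum_(t < T) (y \in L t) <= k0 * T)%N.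
    rewrite exchange_big /= mulnC -[X in (_ <= X * _)%N]card_ord -sum_nat_const.
    apply: leq_sum => t _.
    have -> : (\sum_(y <- s) (y \in L t) = size [seq y <- s | y \in L t])%N.
      rewrite size_filter -sum1_count [RHS]big_mkcond.
      by apply: eq_bigr => y _; case: (y \in L t).
    rewrite -[X in (_ <= X)%N](size_tuple (L t)); apply: uniq_leq_size.
      by rewrite filter_uniq // undup_uniq.
    by move=> y; rewrite mem_filter => /andP[].
  rewrite -(ler_nat R) natrM; apply: le_trans; rewrite natr_sum.
  have -> : (size s)%:R * (theta * T%:R) = \sum_(y <- s) theta * T%:R.
    by rewrite big_const_seq count_predT iter_addr_0 mulr_natl.
  rewrite [leLHS]big_seq [leRHS]big_seq; apply: ler_sum => y.
  by rewrite mem_undup mem_filter => /andP[].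
(* Padding for the slots beyond the number of heavy labels. *)
pose p0 : 'I_T * 'I_k0 := (Ordinal T0, Ordinal k00).
pose pos y := odflt p0 [pick p | entry p == y].
exists [ffun l : 'I_k => pos (nth (entry p0) s l)] => y hy.
have [p py] : exists p, entry p = y.
  have : 0 < (\sum_(t < T) (y \in L t))%:R :> R.
    by rewrite (lt_le_trans _ hy) // mulr_gt0 // ltr0n.
  rewrite ltr0n lt0n sum_nat_eq0 negb_forall => /existsP[t].
  rewrite /= eqb0 negbK => /tnthP[i ->].
  by exists (t, i).
have ys : y \in s.
  rewrite mem_undup mem_filter; apply/andP; split; first exact: hy.
  by rewrite -py map_f // mem_enum.
have lk : (index y s < k)%N by rewrite (leq_trans _ sz_s) // index_mem.
exists (Ordinal lk); rewrite ffunE /= nth_index // /pos.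
by case: pickP => [r /eqP <- //|/(_ p)]; rewrite py eqxx.
Qed.

(** Raising [1 + z <= expR z] at [z = c * n / k.+1] to the power [k.+1] gives the lower bound
    [n ^+ k.+1 / r], one power of [n] more than needed. *)
Lemma expR_gt_exprn (R : realType) (k : nat) (c K : R) : 0 < c ->
  exists n0 : nat, forall n : nat, (n0 <= n)%N -> K * n%:R ^+ k < expR (c * n%:R).
Proof.
move=> c0; pose r := (k.+1%:R / c) ^+ k.+1.
exists (Num.truncn (`|K| * r)).+1 => n hn.
have r0 : 0 < r by rewrite exprn_gt0 // divr_gt0.
have nK : `|K| * r < n%:R.
  by rewrite (lt_le_trans (truncnS_gt _)) // ler_nat.
have n0 : 0 < n%:R :> R by rewrite (le_lt_trans _ nK) // mulr_ge0 // ltW.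
apply: (@le_lt_trans _ _ (`|K| * n%:R ^+ k)).
  by rewrite ler_wpM2r ?ler_norm // exprn_ge0 // ltW.
have k0 : 0 < k.+1%:R :> R by rewrite ltr0n.
pose z := c * n%:R / k.+1%:R.
have z0 : 0 <= z by rewrite divr_ge0 // ?mulr_ge0 // ltW.
have step : z ^+ k.+1 <= expR (c * n%:R).
  have -> : c * n%:R = z * k.+1%:R by rewrite mulfVK // gt_eqF.
  rewrite expRM_natr.
  rewrite lerXn2r ?nnegrE ?expR_ge0 //.
  by rewrite (le_trans _ (expR_ge1Dx z)) // lerDr.
apply: lt_le_trans step.
have -> : z ^+ k.+1 = n%:R ^+ k * (n%:R / r).
  have -> : z = n%:R / (k.+1%:R / c) by rewrite /z invf_div mulrA [n%:R * c]mulrC.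
  by rewrite expr_div_n mulrA -exprSr.
by rewrite mulrC ltr_pM2l ?exprn_gt0 // ltr_pdivlMr.
Qed.

(* [T n] is the integer part of the cube root of [n]: large compared with [ln n],
   but with [T n * ln n] small compared with [n]. *)
Lemma sampling_schedule (R : realType) (eps0 delta0 : R) (m0 : nat) :
  0 < eps0 -> 0 < delta0 < 1 ->
  exists T : nat -> nat, forall eps delta : R, 0 < eps -> 0 < delta ->
  exists n1 : nat, forall n, (n1 <= n)%N ->
  [/\ (0 < n)%N && (0 < T n)%N, (m0 * T n <= n)%N,
    (forall m : nat, 2 * eps0 * (T n)%:R < m%:R ->
      n%:R * (1 + eps0) ^+ T n < 2 ^+ m),
    ((T n).+1 ^ n)%:R * delta0 ^+ (n ^ 2) <= delta &
    ((n ^ m0 * n ^ 2) ^ T n)%:R * expR (- eps) ^+ (n - m0 * T n) <= delta].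
Proof.
move=> e0 /andP[d0 d1].
have Tex n : exists T, (T ^ 3 <= n < T.+1 ^ 3)%N.
  have ex : exists T, (T ^ 3 <= n)%N by exists 0%N.
  have bd T : (T ^ 3 <= n)%N -> (T <= n)%N.
    by apply: leq_trans; rewrite -[X in (X <= _)%N]expn1; case: T => // T; rewrite leq_pexp2l.
  case: (ex_maxnP ex bd) => T TP Tmax; exists T; rewrite TP ltnNge.
  by apply/negP => /Tmax; rewrite ltnn.
have [T TP] := choice Tex.
exists T => eps delta eps_gt0 delta_gt0.
have Tlarge t : exists n1, forall n, (n1 <= n)%N -> (t <= T n)%N.
  exists (t ^ 3)%N => n tn; have /andP[_ ltn] := TP n.
  by rewrite -ltnS -(@ltn_exp2r _ _ 3) // (leq_ltn_trans tn).
(* [n * (1 + eps0) ^+ T <= n * expR (eps0 * T)] is to lie below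
   [2 `^ (2 * eps0 * T)], hence the rate [eps0 * (2 * ln 2 - 1)]. *)
have c1 : 0 < eps0 * (2 * ln 2 - 1).
  (* Positivity amounts to [ln 2 > 1 / 2], which follows from [1 - 1 / 2 < expR (- 1 / 2)]. *)
  rewrite mulr_gt0 // subr_gt0 -ltr_pdivrMl // mulr1.
  rewrite -(opprK 2^-1) -[ln 2]opprK -lnV ?posrE // ltrN2 -ltr_expR lnK ?posrE //.
  apply: le_lt_trans (expR_gt1Dx (_ : - 2^-1 != 0)); first lra.
  by rewrite oppr_eq0 invr_eq0.
(* The constants 8 and 3 come from [n < (T n).+1 ^ 3 <= 8 * T n ^ 3]. *)
have [t1 t1P] := expR_gt_exprn 3 (8 : R) c1.
have c3 : 0 < - ln delta0 by rewrite oppr_gt0 ln_lt0 // d0.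
have [n3 n3P] := expR_gt_exprn 1 (Num.max 2 (2 / delta)) c3.
(* With [K < t], where [t] is [T n], the decay [eps * t ^+ 3] exceeds [3 * (m0 + 2) * t ^+ 2],
   [eps * m0 * t] and [|ln delta|] together, as the last bound demands. The summand [m0 + 1] yields
   [m0 <= T n] and [1 < t]. *)
pose K := (4 * (m0%:R + 2) + eps * m0%:R + `|ln delta|) / eps + m0%:R + 1.
have [n4 n4P] := Tlarge (maxn t1 (Num.truncn K).+1).
exists (maxn n3 n4) => n; rewrite geq_max => /andP[nn3 nn4].
have := n4P _ nn4; rewrite geq_max => /andP[Tt1 TK].
have {}TK : K < (T n)%:R.
  by rewrite (lt_le_trans (truncnS_gt _)) // ler_nat.
have /andP[Tn nT] := TP n.
pose t := (T n)%:R : R.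
have eK : eps * K = 4 * (m0%:R + 2) + eps * m0%:R + `|ln delta| + eps * (m0%:R + 1).
  by rewrite /K; field; lra.
have m0R : 0 <= m0%:R :> R by [].
have K1 : m0%:R + 1 <= K.
  by rewrite /K -addrA lerDr divr_ge0 ?addr_ge0 ?mulr_ge0 ?normr_ge0 // ltW.
have t_gt1 : 1 < t by rewrite /t; lra.
have T_gt0 : (0 < T n)%N by rewrite -(ltr0n R) (lt_trans ltr01).
have Tm0 : (m0 <= T n)%N by rewrite -(ler_nat R); lra.
have n_gt0 : (0 < n)%N by rewrite (leq_trans _ Tn) // expn_gt0 T_gt0.
have m0Tn : (m0 * T n <= n)%N.
  rewrite (leq_trans _ Tn) // expnSr leq_mul2r (leq_trans Tm0) ?orbT //.
  by rewrite expnSr leq_pmull.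
have n8 : n%:R <= 8 * t ^+ 3.
  have : (n <= 8 * T n ^ 3)%N.
    rewrite (leq_trans (ltnW nT)) // -[8%N]/(2 ^ 3)%N -expnMn leq_exp2r //.
    by rewrite mul2n -addnn -addn1 leq_add2l.
  by rewrite -(ler_nat R) natrM natrX.
have nexp : n%:R <= expR (3 * t).
  rewrite expRM_natl (@le_trans _ _ ((T n).+1 ^ 3)%:R) ?ler_nat ?(ltnW nT) //.
  by rewrite natrX lerXn2r ?nnegrE ?expR_ge0 // -natr1 addrC expR_ge1Dx.
split=> //; first by rewrite n_gt0.
- move=> m mT.
  have -> : 2 ^+ m = expR (m%:R * ln 2) :> R by rewrite expRM_natl lnK ?posrE.
  have ln2 : 0 < ln 2 :> R by rewrite ln_gt0 // ltr1n.
  apply: (@lt_trans _ _ (expR (2 * eps0 * t * ln 2))); last first.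
    by rewrite ltr_expR ltr_pM2r.
  have -> : 2 * eps0 * t * ln 2 = eps0 * (2 * ln 2 - 1) * t + eps0 * t by ring.
  rewrite expRD (le_lt_trans (_ : _ <= 8 * t ^+ 3 * expR (eps0 * t))) //.
    have e1 : 0 <= 1 + eps0 by lra.
    apply: ler_pM => //; first exact: exprn_ge0.
    have -> : expR (eps0 * t) = expR eps0 ^+ T n by rewrite expRM_natr.
    by rewrite lerXn2r ?nnegrE ?expR_ge0 ?expR_ge1Dx.
  by rewrite ltr_pM2r ?expR_gt0 // t1P.
- have := n3P _ nn3; rewrite expr1 => large.
  have dn : delta0 ^+ n = (expR (- ln delta0 * n%:R))^-1.
    by rewrite -expRN mulNr opprK expRM_natr lnK ?posrE.
  (* The quantity to bound is [x ^+ n], so [x <= 1] and [x <= delta] suffice. Having [n ^ 2] seeds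
     is what provides one factor [delta0 ^+ n] for each of the [n] factors [(T n).+1]. *)
  pose x := (T n).+1%:R * delta0 ^+ n : R.
  have x_ge0 : 0 <= x by rewrite mulr_ge0 ?exprn_ge0 // ltW.
  have Tn2 : (T n).+1%:R <= 2 * n%:R :> R.
    rewrite -natrM ler_nat mul2n -addnn -addn1 leq_add // (leq_trans _ Tn) //.
    by rewrite -[X in (X <= _)%N]expn1 leq_pexp2l.
  have bound b : 2 / b <= Num.max 2 (2 / delta) -> 0 < b -> x <= b.
    move=> hb b0; rewrite /x dn ler_pdivrMr ?expR_gt0 //.
    rewrite (le_trans Tn2) // -ler_pdivrMl // mulrA [b^-1 * 2]mulrC.
    by rewrite (le_trans _ (ltW large)) // ler_wpM2r.
  have x1 : x <= 1 by rewrite bound // divr1 le_max lexx.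
  have xd : x <= delta by rewrite bound // le_max lexx orbT.
  have -> : ((T n).+1 ^ n)%:R * delta0 ^+ (n ^ 2) = x ^+ n.
    by rewrite natrX /x exprMn -exprM mulnn.
  by rewrite (le_trans _ xd) // -[leRHS]expr1 ler_wiXn2l.
- have -> : ((n ^ m0 * n ^ 2) ^ T n)%:R = n%:R ^+ ((m0 + 2) * T n) :> R.
    by rewrite -expnD -expnM natrX.
  apply: (@le_trans _ _ (expR (3 * t * ((m0 + 2) * T n)%:R) *
                         expR (- eps * (n - m0 * T n)%:R))).
    apply: ler_pM; [exact: exprn_ge0|by rewrite exprn_ge0 ?expR_ge0| |].
      by rewrite (expRM_natr _ (3 * t)) lerXn2r ?nnegrE ?expR_ge0.
    by rewrite (expRM_natr _ (- eps)).
  rewrite -expRD -[delta in leRHS]lnK ?posrE // ler_expR.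
  rewrite natrB // !natrM natrD -/t.
  have Tn' : t ^+ 3 <= n%:R by rewrite -natrX ler_nat.
  have lnd : - `|ln delta| <= ln delta by rewrite lerNl -normrN ler_norm.
  have t2 : t <= t ^+ 2 by rewrite expr2 ler_peMr // ltW // (lt_trans ltr01).
  have t3 : eps * K * t ^+ 2 <= eps * t ^+ 3.
    have -> : eps * t ^+ 3 = eps * t * t ^+ 2 by ring.
    by rewrite ler_wpM2r ?exprn_ge0 // ler_wpM2l // ltW.
  have epsTn : eps * t ^+ 3 <= eps * n%:R by rewrite ler_wpM2l // ltW.
  have lt2 : `|ln delta| <= `|ln delta| * t ^+ 2.
    by rewrite ler_peMr // (le_trans (ltW t_gt1)).
  have mt2 : eps * m0%:R * t <= eps * m0%:R * t ^+ 2.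
    by rewrite ler_wpM2l // mulr_ge0 // ltW.
  have : 0 <= (m0%:R + 2 + eps * (m0%:R + 1)) * t ^+ 2.
    by rewrite mulr_ge0 ?exprn_ge0 ?addr_ge0 ?mulr_ge0 ?addr_ge0 // ltW // (lt_trans ltr01).
  rewrite eK in t3; nra.
Qed.

(** * Product probabilities and generalization *)

Lemma measurable_forall d (T : measurableType d) (I : finType)
    (P : I -> set T) :
  (forall i, measurable (P i)) -> measurable [set x | forall i, P i x].
Proof.
move=> mP; rewrite (_ : mkset _ = \bigcap_(i in setT) P i).
  by apply: fin_bigcap_measurable => //; exact: finite_finset.
by apply/seteqP; split=> x /= h i //; apply: h.
Qed.

Lemma measurable_exists d (T : measurableType d) (I : finType)
    (P : I -> set T) :
  (forall i, measurable (P i)) -> measurable [set x | exists i, P i x].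
Proof.
move=> mP; rewrite (_ : mkset _ = \bigcup_(i in setT) P i).
  by apply: fin_bigcup_measurable => //; exact: finite_finset.
by apply/seteqP; split=> x /= [i]; exists i.
Qed.

Lemma measurable_section_le d1 d2 (T1 : measurableType d1)
    (T2 : measurableType d2) (R : realType) (P : probability T2 R)
    (E : set (T1 * T2)) (a : \bar R) :
  measurable E -> measurable [set x | P (xsection E x) <= a]%E.
Proof.
move=> mE; rewrite -[mkset _]setTI.
rewrite (_ : mkset _ = (P \o xsection E) @^-1` `]-oo, a]).
  by apply: (measurable_fun_xsection P mE) => //; exact: emeasurable_itv.
by apply/seteqP; split=> x; rewrite /= in_itv.
Qed.

Lemma measurable_section_ge d1 d2 (T1 : measurableType d1)
    (T2 : measurableType d2) (R : realType) (P : probability T2 R)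
    (E : set (T1 * T2)) (a : \bar R) :
  measurable E -> measurable [set x | a <= P (xsection E x)]%E.
Proof.
move=> mE; rewrite -[mkset _]setTI.
rewrite (_ : mkset _ = (P \o xsection E) @^-1` `[a, +oo[).
  by apply: (measurable_fun_xsection P mE) => //; exact: emeasurable_itv.
by apply/seteqP; split=> x; rewrite /= in_itv /= andbT.
Qed.

Lemma union_bound d (T : measurableType d) (R : realType)
    (P : probability T R) (I : finType) (A : set T) (F : I -> set T) (c : R) :
  measurable A -> (forall i, measurable (F i)) ->
  (forall x, A x -> exists i, F i x) ->
  (forall i, P (F i) <= c%:E)%E -> (P A <= (#|I|%:R * c)%:E)%E.
Proof.
move=> mA mF AF Fc.
have /le_trans : (P A <= \sum_(i \in [set: I]) P (F i))%E.
  apply: content_sub_fsum => //; first exact: finite_finset.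
  by move=> x /AF[i ?]; exists i.
apply; rewrite (_ : setT = [set` index_enum I]); last first.
  by apply/seteqP; split=> i //= _; rewrite mem_index_enum.
rewrite -fsbig_seq ?index_enum_uniq //.
have -> : (#|I|%:R * c)%:E = (\sum_(i : I) c%:E)%E.
  by rewrite sumEFin sumr_const mulr_natl.
by apply: lee_sum => i _; exact: Fc.
Qed.

Lemma product_probability_le d1 d2 (T1 : measurableType d1)
    (T2 : measurableType d2) (R : realType) (P1 : probability T1 R)
    (P2 : probability T2 R) (E : set (T1 * T2)) (c : R) :
  measurable E -> (forall x, P2 (xsection E x) <= c%:E)%E ->
  ((P1 \x P2) E <= c%:E)%E.
Proof.
move=> mE Ec; rewrite /product_measure1.
have -> : c%:E = (\int[P1]_x cst c%:E x)%E.
  by rewrite integral_cst // [X in (_ * X)%E]probability_setT mule1.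
apply: ge0_le_integral => //; first exact: measurable_fun_xsection.
by move=> x _; exact: Ec.
Qed.

Lemma product_probabilityC d1 d2 (T1 : measurableType d1)
    (T2 : measurableType d2) (R : realType) (P1 : probability T1 R)
    (P2 : probability T2 R) (E : set (T1 * T2)) :
  measurable E -> ((P1 \x P2) E = \int[P2]_y P1 (ysection E y))%E.
Proof.
move=> mE; rewrite (@product_measure_unique _ _ _ _ _ P1 P2 (P1 \x^ P2)%E) //.
by move=> A B mA mB; exact: product_measure2E.
Qed.

Lemma product_probability_le_r d1 d2 (T1 : measurableType d1)
    (T2 : measurableType d2) (R : realType) (P1 : probability T1 R)
    (P2 : probability T2 R) (E : set (T1 * T2)) (c : R) :
  measurable E -> (forall y, P1 (ysection E y) <= c%:E)%E ->
  ((P1 \x P2) E <= c%:E)%E.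
Proof.
move=> mE Ec; rewrite product_probabilityC //.
have -> : c%:E = (\int[P2]_x cst c%:E x)%E.
  by rewrite integral_cst // [X in (_ * X)%E]probability_setT mule1.
by apply: ge0_le_integral => //; exact: (measurable_fun_ysection P1).
Qed.

Lemma measurable_tnth_preimage d (Z : measurableType d) n (i : 'I_n)
    (A : set Z) : measurable A -> measurable [set S : n.-tuple Z | A (tnth S i)].
Proof. by move=> mA; rewrite -[X in measurable X]setTI; exact: measurable_tnth. Qed.

Lemma iid_all d (Z : measurableType d) (R : realType) (D : probability Z R)
    (A : set Z) (a : R) (n : nat) : measurable A -> D A = a%:E ->
  iid D n [set S | forall i, A (tnth S i)] = (a ^+ n)%:E.
Proof.
move=> mA Da; elim: n => [|n IH] /=.
  by rewrite diracE mem_set // => -[].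
rewrite /distribution /pushforward.
rewrite (_ : _ @^-1` _ = A `*` [set S | forall i, A (tnth S i)]).
  have mS : measurable [set S : n.-tuple Z | forall i, A (tnth S i)].
    by apply: measurable_forall => i; exact: measurable_tnth_preimage.
  apply: eq_trans (product_measure1E D (iid D n) mA mS) _.
  transitivity (D A * iid D n [set S | forall i, A (tnth S i)])%E => //.
  by rewrite Da IH -EFinM exprS.
apply/seteqP; split=> -[z S] /=.
  by move=> h; split=> [|i]; [have := h ord0|have := h (lift ord0 i)];
    rewrite ?tnth0 ?tnthS.
move=> [Az AS] i; case: (unliftP ord0 i) => [j|] ->; last by rewrite tnth0.
by rewrite tnthS.
Qed.

(** The bad event of sample compression: think of [E] as the points handled correctly by a rule
    built from the coordinates in [I]; its mass is small, yet it contains every held-out point. *)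
Definition overfit d (Z : measurableType d) (R : realType)
    (D : probability Z R) (a : R) n (I : pred 'I_n) (E : set (n.-tuple Z * Z)) :=
  [set S : n.-tuple Z | (D (xsection E S) <= a%:E)%E /\
    forall i, ~~ I i -> E (S, tnth S i)].

Lemma measurable_overfit d (Z : measurableType d) (R : realType)
    (D : probability Z R) (a : R) n (I : pred 'I_n) (E : set (n.-tuple Z * Z)) :
  measurable E -> measurable (overfit D a I E).
Proof.
move=> mE; apply: measurableI; first exact: measurable_section_le.
apply: (@measurable_forall _ _ _ (fun i =>
  [set S | ~~ I i -> E (S, tnth S i)])) => i.
have [Ii|nIi] := boolP (I i).
  by rewrite (_ : mkset _ = setT) //; apply/seteqP; split.
rewrite (_ : mkset _ = (fun S => (S, tnth S i)) @^-1` E); last first.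
  by apply/seteqP; split=> S /= // /(_ isT).
rewrite -[X in measurable X]setTI; apply: measurable_fun_pair => //.
exact: measurable_tnth.
Qed.

(* Conditionally on the coordinates in [I] the set [xsection E S] is fixed, and
   the remaining coordinates are independent of it. *)
Lemma overfit_le d (Z : measurableType d) (R : realType)
    (D : probability Z R) (a : R) n (I : pred 'I_n) (E : set (n.-tuple Z * Z)) :
  0 <= a -> measurable E ->
  (forall S S' z, (forall i, I i -> tnth S i = tnth S' i) ->
    E (S, z) -> E (S', z)) ->
  (iid D n (overfit D a I E) <= (a ^+ (\sum_(i < n) ~~ I i))%:E)%E.
Proof.
move=> a0; elim: n => [|n IH] in I E * => mE EI.
  by rewrite big_ord0 expr0 probability_le1 //; exact: measurable_overfit.
pose Ez z := [set p : n.-tuple Z * Z | E (cons_sample (z, p.1), p.2)].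
have mEz z : measurable (Ez z).
  rewrite (_ : Ez z = (fun p => (cons_sample (z, p.1), p.2)) @^-1` E) //.
  rewrite -[X in measurable X]setTI; apply: measurable_fun_pair => //.
  apply: (measurableT_comp (f := @cons_sample _ _ n)
    (g := fun p : n.-tuple Z * Z => (z, p.1))); first exact: measurable_cons_sample.
  exact: measurable_fun_pair.
have xEz z S : xsection (Ez z) S = xsection E (cons_sample (z, S)).
  by apply/seteqP; split=> y /=; rewrite /xsection /= !inE.
pose I' (i : 'I_n) := I (lift ord0 i).
have EzI z S S' y : (forall i, I' i -> tnth S i = tnth S' i) ->
    Ez z (S, y) -> Ez z (S', y).
  move=> SS'; apply: EI => i; case: (unliftP ord0 i) => [j|] ->.
    by move=> /SS'; rewrite !tnthS.
  by rewrite !tnth0.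
have mB := measurable_overfit D a I mE.
have mB' : measurable (@cons_sample _ _ n @^-1` overfit D a I E).
  rewrite -[X in measurable X]setTI; exact: measurable_cons_sample.
rewrite /= /distribution /pushforward big_ord_recl.
have [I0|nI0] := boolP (I ord0).
  (* The first coordinate is not a test point: the exponent is unchanged, and the induction
     hypothesis applies to the slice at each [z]. *)
  apply: product_probability_le => // z.
  apply: le_trans (IH _ _ (mEz z) (EzI z)).
  apply: le_measure; rewrite ?inE; [exact: measurable_xsection| |].
    exact: measurable_overfit.
  move=> S; rewrite /xsection /= inE /= => -[h1 h2]; split; first by rewrite xEz.
  by move=> i nI'i; have := h2 _ nI'i; rewrite tnthS.
rewrite product_probabilityC // exprS EFinM.
(* The first coordinate is a test point: [E] ignores its value, so the slice at the arbitrary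
   [point] represents all slices. *)
pose B := overfit D a I' (Ez point).
have mBB : measurable B by exact: measurable_overfit.
have -> : (a%:E * (a ^+ (\sum_(i < n) ~~ I (lift ord0 i)))%:E =
           (a ^+ (\sum_(i < n) ~~ I' i))%:E * a%:E)%E by rewrite muleC.
apply: (@le_trans _ _ (iid D n B * a%:E)%E); last first.
  by rewrite lee_wpmul2r // ?lee_fin //; exact: (IH _ _ (mEz point) (EzI point)).
have -> : (iid D n B * a%:E = \int[iid D n]_S ((\1_B S)%:E * a%:E))%E.
  rewrite ge0_integralZr ?lee_fin //; first by rewrite integral_indic ?setIT.
  by apply/measurable_EFinP; exact: measurable_indic.
apply: ge0_le_integral => //.
- by apply: (@measurable_fun_ysection _ _ _ _ _ D).
- apply: emeasurable_funM => //.
  by apply/measurable_EFinP; exact: measurable_indic.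
move=> S _; rewrite indicE.
have indep z : xsection E (cons_sample (z, S)) = xsection (Ez point) S.
  rewrite xEz; apply/seteqP; split=> y; rewrite /xsection /= !inE => h;
  by apply: EI h => i; case: (unliftP ord0 i) => [j|] ->;
    rewrite ?tnthS // (negPf nI0).
(* On [B] the first point must fall in a section of mass at most [a]; off [B] the fibre is empty. *)
have [/set_mem BS|/negP nBS] := boolP (S \in B); rewrite /= ?mul1e ?mul0e.
  case: (BS) => BS1 _; apply: le_trans BS1.
  apply: le_measure; rewrite ?inE; [exact: measurable_ysection|exact: measurable_xsection|].
  move=> z; rewrite -(indep z) /ysection /xsection /= !inE => -[_ /(_ _ nI0)].
  by rewrite tnth0.
rewrite (_ : ysection _ _ = set0) ?measure0 //.
rewrite -subset0 => z; rewrite /ysection /= inE => -[h1 h2].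
apply: nBS; rewrite inE; split; first by rewrite -(indep z).
move=> i nI'i; have := h2 _ nI'i; rewrite tnthS => h.
have : xsection E (cons_sample (z, S)) (tnth S i) by rewrite /xsection /= inE.
by rewrite indep /xsection /= inE.
Qed.

(** * Weighted samples *)

Lemma weighted_average_le (R : realType) n (p : 'I_n -> R) (F : 'I_n -> \bar R) :
  (forall i, 0 <= p i) -> \sum_i p i = 1 -> (forall i, 0 <= F i)%E ->
  exists i, (\sum_i (p i)%:E * F i <= F i)%E.
Proof.
move=> p0 p1 F0.
case: n p F p0 p1 F0 => [p F _|n p F p0 p1 F0].
  by rewrite big_ord0 => /esym/eqP; rewrite oner_eq0.
case: (@Order.TotalTheory.arg_maxP _ _ _ ord0 xpredT F isT) => i _ Fmax.
exists i; apply: (@le_trans _ _ (\sum_j (p j)%:E * F i)%E).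
  by apply: lee_sum => j _; rewrite lee_wpmul2l ?lee_fin //; exact: Fmax.
rewrite -ge0_sume_distrl; last by move=> j _; rewrite lee_fin.
by rewrite sumEFin p1 mul1e.
Qed.

(** A finite sum of scaled Dirac masses. The formula for [D A] holds for every set, so the error of
    a hypothesis can be computed without knowing it measurable. *)
Lemma weighted_sample_law d (Z : measurableType d) (R : realType) n
    (z : 'I_n -> Z) (p : 'I_n -> R) :
  (forall i, 0 <= p i) -> \sum_i p i = 1 ->
  exists D : probability Z R,
    (forall A, D A = (\sum_i p i * \1_A (z i))%:E) /\
    (forall f, measurable_fun setT f -> (forall x, 0 <= f x)%E ->
      (\int[D]_x f x = \sum_i (p i)%:E * f (z i))%E).
Proof.
move=> p0 p1.
pose m_ (k : nat) : {measure set Z -> \bar R} :=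
  match insub k with
  | Some i => mscale (NngNum (p0 i)) (dirac (z i))
  | None => mzero
  end.
have mE (i : 'I_n) A : m_ i A = ((p i)%:E * (\1_A (z i))%:E)%E.
  by rewrite /m_ valK.
have sE A : msum m_ n A = (\sum_i p i * \1_A (z i))%:E.
  by rewrite /msum -sumEFin; apply: eq_bigr => i _; rewrite mE.
have s1 : msum m_ n setT = 1%E.
  by rewrite sE; congr EFin; rewrite -p1; apply: eq_bigr => i _; rewrite indicT mulr1.
pose D : probability Z R :=
  HB.pack (msum m_ n) (Measure_isProbability.Build _ _ _ (msum m_ n) s1).
exists D; split => [A|f mf f0]; first exact: sE.
rewrite (ge0_integral_measure_sum m_ measurableT) //.
apply: eq_bigr => i _; rewrite /m_ valK ge0_integral_mscale //.
by rewrite integral_dirac // diracT mul1e.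
Qed.

(** By Tonelli the coordinates can be fixed one at a time, the first one outermost, each at some
    [z i] that does not lower the integral. *)
Lemma iid_average_le d (Z : measurableType d) (R : realType) n (z : 'I_n -> Z)
    (D : probability Z R) :
  (forall f, measurable_fun setT f -> (forall x, 0 <= f x)%E ->
    exists i, (\int[D]_x f x <= f (z i))%E) ->
  forall m (f : m.-tuple Z -> \bar R), measurable_fun setT f ->
  (forall x, 0 <= f x)%E ->
  exists idx : {ffun 'I_m -> 'I_n},
    (\int[iid D m]_x f x <= f [tuple z (idx j) | j < m])%E.
Proof.
move=> Davg; elim=> [|m IH] f mf f0.
  exists [ffun i : 'I_0 => match ltac:(by case: i) : False with end].
  by rewrite integral_dirac // diracT mul1e [X in (_ <= f X)%E]tuple0.
have mfc : measurable_fun setT (f \o @cons_sample _ Z m).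
  by apply: measurableT_comp => //; exact: measurable_cons_sample.
have -> : (\int[iid D m.+1]_x f x =
           \int[D]_a \int[iid D m]_t f (cons_sample (a, t)))%E.
  rewrite [LHS](ge0_integral_pushforward (@measurable_cons_sample _ Z m)) //.
  rewrite preimage_setT (fubini_tonelli1 (f \o @cons_sample _ Z m)) //.
  by move=> x /=.
have [|a|i le_i] := Davg (fun a => \int[iid D m]_t f (cons_sample (a, t)))%E.
- by apply: (measurable_fun_fubini_tonelli_F _ mfc) => x /=.
- by apply: integral_ge0.
have [||idx le_idx] := IH (fun t => f (cons_sample (z i, t))).
- by apply: (measurableT_comp mfc); exact: measurable_fun_pair.
- by [].
exists [ffun j => if unlift ord0 j is Some j' then idx j' else i].
apply: le_trans le_i (le_trans le_idx _).
rewrite le_eqVlt; apply/orP; left; apply/eqP; congr f.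
apply: eq_from_tnth => j; rewrite tnth_mktuple ffunE.
by case: unliftP => [j'|] ->; rewrite ?tnthS ?tnth0 ?tnth_mktuple.
Qed.

(** The joint probability averages, over the sample, a probability over the seed; only the sample is
    fixed and the seed stays random. *)
Lemma iid_derandomize d dU (Z : measurableType d) (U : measurableType dU)
    (R : realType) n (z : 'I_n -> Z) (D : probability Z R)
    (P : probability U R) m (E : set (m.-tuple Z * U)) (c : \bar R) :
  (forall f, measurable_fun setT f -> (forall x, 0 <= f x)%E ->
    exists i, (\int[D]_x f x <= f (z i))%E) ->
  measurable E -> (c <= (iid D m \x P) E)%E ->
  exists idx : {ffun 'I_m -> 'I_n},
    (c <= P (xsection E [tuple z (idx j) | j < m]))%E.
Proof.
move=> Davg mE cE.
have [||idx le_idx] := iid_average_le Davg (f := P \o xsection E) (m := m).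
- exact: measurable_fun_xsection.
- by move=> x /=.
by exists idx; apply: le_trans cE le_idx.
Qed.

(** * Measurable finite choices *)

(** [g] follows the first index in the enumeration of [F] whose event holds at [w], and is [point]
    where none holds. *)
Lemma measurable_selection d1 d2 d3 (W : measurableType d1)
    (X : measurableType d2) (V : measurableType d3) (F : finType)
    (P : F -> set W) (u : F -> W -> X -> V) :
  (forall f, measurable (P f)) ->
  (forall f, measurable_fun setT (fun p : W * X => u f p.1 p.2)) ->
  exists g : W -> X -> V, measurable_fun setT (fun p : W * X => g p.1 p.2) /\
    forall w, (exists f, P f w) -> exists f, P f w /\ g w = u f w.
Proof.
move=> mP mu.
suff [g [mg gP]] : exists g : W -> X -> V,
    measurable_fun setT (fun p : W * X => g p.1 p.2) /\
    forall w, (exists2 f, f \in enum F & P f w) ->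
      exists f, P f w /\ g w = u f w.
  by exists g; split=> // w [f Pf]; apply: gP; exists f; rewrite ?mem_enum.
elim: (enum F) => [|f s [g [mg gP]]].
  by exists (fun _ _ => point); split=> [|w [f]]; [exact: measurable_cst|].
exists (fun w => if `[< P f w >] then u f w else g w); split.
  rewrite (_ : (fun p => _) =
      (fun p : W * X => if `[< P f p.1 >] then u f p.1 p.2 else g p.1 p.2)).
    apply: measurable_fun_ifT => //; apply: (measurable_fun_bool true).
    rewrite setTI (_ : _ @^-1` _ = fst @^-1` P f).
      by rewrite -[X in measurable X]setTI; exact: measurable_fst.
    by apply/seteqP; split=> p /= /asboolP.
  by apply/funext => p; case: ifP.
move=> w [h]; rewrite inE => hs Ph; case: asboolP => [Pf|nPf].
  by exists f.
apply: gP; exists h => //; case/orP: hs => // /eqP hf.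
by rewrite hf in Ph.
Qed.

(** The set is a finite union of atoms of the partition generated by the [B i], whatever [Q] is. *)
Lemma measurable_pattern d (W : measurableType d) (I : finType)
    (B : I -> set W) (Q : {ffun I -> bool} -> Prop) :
  (forall i, measurable (B i)) ->
  measurable [set w | Q [ffun i => `[< B i w >]]].
Proof.
move=> mB.
pose C b := [set w : W | Q b /\ forall i, (~ B i w <-> b i = false)].
rewrite (_ : mkset _ = [set w | exists b, C b w]).
  apply: measurable_exists => b; have [Qb|nQb] := pselect (Q b); last first.
    by rewrite (_ : C b = set0) // -subset0 => w [].
  rewrite (_ : C b = [set w | forall i, (~ B i w <-> b i = false)]).
    apply: (@measurable_forall _ _ _ (fun i => [set w | ~ B i w <-> b i = false])).
    move=> i; case: (b i).
      rewrite (_ : mkset _ = B i) //; apply/seteqP; split=> w /=.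
        by move=> h; apply: contrapT => /h.
      by move=> Bw; split.
    rewrite (_ : mkset _ = ~` B i); first exact: measurableC.
    by apply/seteqP; split=> w /=; [move=> h; apply/h|].
  by apply/seteqP; split=> w; [case|].
apply/seteqP; split=> w /=.
  move=> Qw; exists [ffun i => `[< B i w >]]; split=> // i.
  by rewrite ffunE; split=> [/asboolPn/negbTE|/negbT/asboolPn].
move=> [b [Qb bP]]; rewrite (_ : finfun _ = b) //.
apply/ffunP => i; rewrite ffunE; case bi: (b i).
  by apply/asboolP; apply: contrapT => /bP; rewrite bi.
by apply/negbTE/asboolPn; apply/bP.
Qed.

Definition heavy (R : realType) (Y : eqType) T k0 (theta : R)
    (L : 'I_T -> k0.-tuple Y) (y : Y) : Prop :=
  theta * T%:R <= (\sum_(t < T) (y \in L t))%:R.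

Section measurable_lists.
Context dY (Y : measurableType dY).
Hypothesis mdiagY : measurable [set p : Y * Y | p.1 = p.2].

Lemma measurable_eq d (W : measurableType d) (f g : W -> Y) :
  measurable_fun setT f -> measurable_fun setT g ->
  measurable [set w | f w = g w].
Proof.
move=> mf mg.
rewrite (_ : mkset _ = (fun w => (f w, g w)) @^-1` [set p | p.1 = p.2]) //.
by rewrite -[X in measurable X]setTI; apply: measurable_fun_pair.
Qed.

Lemma measurable_mem d (W : measurableType d) k (L : W -> k.-tuple Y)
    (y : W -> Y) : measurable_fun setT L -> measurable_fun setT y ->
  measurable [set w | y w \in L w].
Proof.
move=> /measurable_fun_tnthP mL my.
rewrite (_ : mkset _ = [set w | exists i, y w = tnth (L w) i]).
  apply: (@measurable_exists _ _ _ (fun i => [set w | y w = tnth (L w) i])) => i.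
  by apply: measurable_eq => //; exact: mL.
by apply/seteqP; split=> w /=; [move=> /tnthP|move=> h; apply/tnthP].
Qed.

Lemma measurable_heavy (R : realType) d (W : measurableType d) T k0 (theta : R)
    (L : 'I_T -> W -> k0.-tuple Y) (y : W -> Y) :
  (forall t, measurable_fun setT (L t)) -> measurable_fun setT y ->
  measurable [set w | heavy theta (L^~ w) (y w)].
Proof.
move=> mL my.
have := @measurable_pattern _ W 'I_T (fun t => [set w | y w \in L t w])
  (fun b => theta * T%:R <= (\sum_(t < T) b t)%:R)
  (fun t => measurable_mem (mL t) my).
congr measurable; apply/seteqP; split=> w; rewrite /= /heavy;
by under eq_bigr do rewrite ffunE asboolb.
Qed.

(** At each [(w, x)], [heavy_labels] provides addresses covering the heavy labels; address tuples
    are finite in number, so one can be selected measurably. *)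
Lemma majority_list (R : realType) d1 d2 (W : measurableType d1)
    (X : measurableType d2) T k0 (theta : R)
    (L : 'I_T -> W -> X -> k0.-tuple Y) :
  0 < theta -> (0 < k0)%N ->
  (forall t, measurable_fun setT (fun p : W * X => L t p.1 p.2)) ->
  exists M : W -> X -> (Num.truncn (k0%:R / theta)).-tuple Y,
    measurable_fun setT (fun p : W * X => M p.1 p.2) /\
    ((0 < T)%N -> forall w x y,
      heavy theta (fun t => L t w x) y -> y \in M w x).
Proof.
move=> theta0 k00 mL; set k := Num.truncn _.
pose entry (r : 'I_T * 'I_k0) (p : W * X) := tnth (L r.1 p.1 p.2) r.2.
have mentry r : measurable_fun setT (entry r).
  by have /measurable_fun_tnthP := mL r.1; apply.
(* A heavy label occurs in some list, so testing the finitely many entries is enough and avoids a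
   quantifier over [Y]. *)
pose P (q : {ffun 'I_k -> 'I_T * 'I_k0}) := [set p | forall r,
  heavy theta (fun t => L t p.1 p.2) (entry r p) ->
  exists l, entry r p = entry (q l) p].
(* The choice depends on the whole pair, which therefore serves as the parameter; the last argument
   is a dummy. *)
pose u (q : {ffun 'I_k -> 'I_T * 'I_k0}) (p : W * X) (_ : X) :=
  [tuple entry (q l) p | l < k].
have [q|q|g [mg gP]] := @measurable_selection _ _ _ _ X _ _ P u.
- pose Hv r := [set p | heavy theta (fun t => L t p.1 p.2) (entry r p)].
  pose Ex r := [set p | exists l, entry r p = entry (q l) p].
  apply: (@measurable_forall _ _ _ (fun r => [set p | Hv r p -> Ex r p])) => r.
  rewrite (_ : mkset _ = ~` Hv r `|` Ex r); last first.
    apply/seteqP; split=> p /=; last by case.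
    by have [h|] := pselect (Hv r p); [move=> /(_ h); right|left].
  apply: measurableU; last first.
    apply: (@measurable_exists _ _ _
      (fun l => [set p | entry r p = entry (q l) p])) => l.
    exact: measurable_eq.
  apply: measurableC.
  exact: (@measurable_heavy _ _ _ _ _ _ (fun t (p : W * X) => L t p.1 p.2)).
- apply/measurable_fun_tnthP => l.
  rewrite (_ : _ \o _ = entry (q l) \o fst); last first.
    by apply/funext => p; rewrite /= tnth_mktuple.
  exact: measurableT_comp.
exists (fun w x => g (w, x) x); split=> [|T0 w x y hy].
  rewrite (_ : (fun p => _) =
    (fun p : (W * X) * X => g p.1 p.2) \o (fun p : W * X => (p, p.2))).
    by apply: measurableT_comp => //; exact: measurable_fun_pair.
  by apply/funext => -[].
have [q qP] := heavy_labels (fun t => L t w x) theta0 T0 k00.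
have [|f [Pf ->]] := gP (w, x).
  by exists q => r /qP[l rl]; exists l.
have [l yl] := qP y hy.
have [|l' yl'] := Pf (q l); first by move: hy; rewrite yl.
rewrite yl; apply/tnthP; exists l'; rewrite tnth_mktuple.
exact: yl'.
Qed.

End measurable_lists.

(** * The boosted learner *)

Section boosted_lists.
Context (R : realType) (dX dY : measure_display).
Context (X : measurableType dX) (Y : measurableType dY).
Context (mdiagY : measurable [set p : Y * Y | p.1 = p.2]).
Context (k0 : nat) (A : list_algorithm R X Y k0) (m0 : nat).

Local Notation Z := (X * Y)%type.
Local Notation U := (seed A m0).
Local Notation P := (seed_law A m0).

Definition subsample n (S : n.-tuple Z) (idx : {ffun 'I_m0 -> 'I_n}) :
  m0.-tuple Z := [tuple tnth S (idx j) | j < m0].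

(* A run of the weak learner is determined by the positions of its examples in
   the sample and by one of the available seeds. *)
Definition run n N := ({ffun 'I_m0 -> 'I_n} * 'I_N)%type.

Definition run_list n N (r : run n N) (w : n.-tuple Z * N.-tuple U) (x : X) :=
  output (subsample w.1 r.1) (tnth w.2 r.2) x.

Definition run_lists n N T (c : {ffun 'I_T -> run n N})
  (w : n.-tuple Z * N.-tuple U) (x : X) (t : 'I_T) := run_list (c t) w x.

Definition fits theta n N T (c : {ffun 'I_T -> run n N})
    (w : n.-tuple Z * N.-tuple U) :=
  forall i, heavy (R := R) theta (run_lists c w (tnth w.1 i).1) (tnth w.1 i).2.

Lemma measurable_subsample n idx :
  measurable_fun setT (fun S : n.-tuple Z => subsample S idx).
Proof.
apply/measurable_fun_tnthP => j.
rewrite (_ : _ \o _ = (@tnth _ Z)^~ (idx j)); first exact: measurable_tnth.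
by apply/funext => S /=; rewrite tnth_mktuple.
Qed.

Lemma measurable_run_list n N (r : run n N) :
  measurable_fun setT (fun p : (n.-tuple Z * N.-tuple U) * X =>
    run_list r p.1 p.2).
Proof.
pose q (p : (n.-tuple Z * N.-tuple U) * X) :=
  ((subsample p.1.1 r.1, tnth p.1.2 r.2), p.2).
have mq : measurable_fun setT q.
  apply: measurable_fun_pair => //; apply: measurable_fun_pair => /=.
    apply: (measurableT_comp (measurable_subsample r.1)).
    exact: measurableT_comp.
  apply: (measurableT_comp (measurable_tnth r.2)).
  exact: measurableT_comp.
pose f (p : (m0.-tuple Z * U) * X) := output p.1.1 p.1.2 p.2.
have mf : measurable_fun setT f := @measurable_output _ _ _ _ _ _ A m0.
rewrite (_ : (fun p => _) = f \o q) //.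
exact: (measurableT_comp mf mq).
Qed.

Lemma measurable_run_heavy theta n N T (c : {ffun 'I_T -> run n N}) :
  measurable [set p : (n.-tuple Z * N.-tuple U) * Z |
    heavy (R := R) theta (run_lists c p.1 p.2.1) p.2.2].
Proof.
pose L t (p : (n.-tuple Z * N.-tuple U) * Z) := run_lists c p.1 p.2.1 t.
apply: (@measurable_heavy _ _ mdiagY _ _ _ _ _ _ L); last first.
  exact: measurableT_comp.
move=> t; rewrite (_ : L t =
  (fun p : (n.-tuple Z * N.-tuple U) * X => run_list (c t) p.1 p.2) \o
  (fun p => (p.1, p.2.1))) //.
apply: (measurableT_comp (measurable_run_list (c t))).
by apply: measurable_fun_pair => //; exact: measurableT_comp.
Qed.

Lemma measurable_fits theta n N T (c : {ffun 'I_T -> run n N}) :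
  measurable (fits theta c).
Proof.
apply: (@measurable_forall _ _ _ (fun i => [set w |
  heavy theta (run_lists c w (tnth w.1 i).1) (tnth w.1 i).2])) => i.
rewrite (_ : mkset _ = (fun w => (w, tnth w.1 i)) @^-1`
  [set p | heavy theta (run_lists c p.1 p.2.1) p.2.2]) //.
rewrite -[X in measurable X]setTI.
apply: (_ : measurable_fun setT _) => //; last exact: measurable_run_heavy.
apply: measurable_fun_pair => //.
by apply: (measurableT_comp (measurable_tnth i)).
Qed.

(** A second selection, now over the finitely many [c]: [g] uses the majority list of some fitting
    [c]. *)
Lemma boosted_output theta n N T : 0 < theta -> (0 < k0)%N ->
  exists g : n.-tuple Z * N.-tuple U -> X ->
             (Num.truncn (k0%:R / theta)).-tuple Y,
    measurable_fun setT (fun p : (n.-tuple Z * N.-tuple U) * X => g p.1 p.2) /\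
    ((0 < T)%N -> forall w, (exists c : {ffun 'I_T -> run n N}, fits theta c w) ->
      exists c : {ffun 'I_T -> run n N}, fits theta c w /\
        forall x y, heavy theta (run_lists c w x) y -> y \in g w x).
Proof.
move=> theta0 k00; set k := Num.truncn _.
have ex (c : {ffun 'I_T -> run n N}) :
    exists M : n.-tuple Z * N.-tuple U -> X -> k.-tuple Y,
    measurable_fun setT (fun p : (n.-tuple Z * N.-tuple U) * X => M p.1 p.2) /\
    ((0 < T)%N -> forall w x y,
      heavy theta (run_lists c w x) y -> y \in M w x).
  have [|M [mM MP]] := majority_list mdiagY
    (L := fun t w x => run_lists c w x t) theta0 k00.
    by move=> t; exact: measurable_run_list.
  by exists M.
have [M MP] := choice ex.
have [c|c|g [mg gP]] := @measurable_selection _ _ _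
    (n.-tuple Z * N.-tuple U)%type X (k.-tuple Y)
    {ffun 'I_T -> run n N} (fun c => fits theta c) M.
- exact: measurable_fits.
- by have [] := MP c.
exists g; split=> // T0 w /gP[c [fc gc]].
exists c; split=> // x y; rewrite gc.
by have [_ /(_ T0)] := MP c; apply.
Qed.

(* Derandomizing the weak learner on the sample itself, weighted by [2 ^+ v]. *)
Lemma good_run (H : set (X -> Y)) (eps0 delta0 : R) n T (S : n.-tuple Z)
    (h : X -> Y) (v : {ffun 'I_n -> 'I_T}) :
  (forall D : probability Z R, realizable H D -> succeeds A D m0 eps0 delta0) ->
  H h -> (forall i, h (tnth S i).1 = (tnth S i).2) -> (0 < n)%N ->
  exists idx, ((1 - delta0)%:E <= P [set s | (\sum_(i | (tnth S i).2 \notin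
      output (subsample S idx) s (tnth S i).1) 2 ^+ v i <=
    eps0 * \sum_i 2 ^+ v i)%R])%E.
Proof.
move=> hA Hh hS n0.
pose W : R := \sum_i 2 ^+ v i.
have W0 : 0 < W.
  rewrite /W (bigD1 (Ordinal n0)) //= ltr_pwDl ?exprn_gt0 //.
  by rewrite sumr_ge0.
pose p i : R := 2 ^+ v i / W.
have p0 i : 0 <= p i by rewrite divr_ge0 // ltW.
have p1 : \sum_i p i = 1 by rewrite -mulr_suml divff // gt_eqF.
have [D [DE Dint]] := weighted_sample_law (tnth S) p0 p1.
have Dreal : realizable H D.
  apply/le_anti/andP; split; last by apply: le_ereal_inf_tmp => _ [h' _ <-].
  apply: ereal_inf_lbound; exists h => //; rewrite DE big1 // => i _.
  by rewrite indicE memNset ?mulr0 //= hS.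
have Davg f : measurable_fun setT f -> (forall x, 0 <= f x)%E ->
    exists i, (\int[D]_x f x <= f (tnth S i))%E.
  by move=> mf f0; rewrite Dint //; exact: weighted_average_le.
pose C := [set q : (m0.-tuple Z * U) * Z | q.2.2 \in output q.1.1 q.1.2 q.2.1].
have mC : measurable C.
  pose L (q : (m0.-tuple Z * U) * Z) := output q.1.1 q.1.2 q.2.1.
  apply: (@measurable_mem _ _ mdiagY _ _ _ L); last exact: measurableT_comp.
  pose f (p : (m0.-tuple Z * U) * X) := output p.1.1 p.1.2 p.2.
  have mf : measurable_fun setT f := @measurable_output _ _ _ _ _ _ A m0.
  apply: (measurableT_comp (g := fun q : (m0.-tuple Z * U) * Z => (q.1, q.2.1)) mf).
  by apply: measurable_fun_pair => //; exact: measurableT_comp.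
have CE w : xsection C w = [set z | z.2 \in output w.1 w.2 z.1].
  by apply/seteqP; split=> z; rewrite /xsection /= inE.
have [||idx idxP] := iid_derandomize (z := tnth S) (P := P)
    (E := [set w | (1 - eps0)%:E <= D (xsection C w)]%E) (c := (1 - delta0)%:E) Davg.
- exact: measurable_section_ge.
- have := hA D Dreal; rewrite /succeeds.
  rewrite (_ : [set w | _] = [set w | (1 - eps0)%:E <= D (xsection C w)]%E) //.
  by apply/seteqP; split=> w /=; rewrite CE.
exists idx; apply: le_trans idxP _.
rewrite le_eqVlt; apply/orP; left; apply/eqP; congr (P _).
pose B (s : U) i := (tnth S i).2 \in output (subsample S idx) s (tnth S i).1.
have covE (s : U) : \sum_i p i * \1_[set z | z.2 \in
    output (subsample S idx) s z.1] (tnth S i) =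
    1 - (\sum_(i | ~~ B s i) 2 ^+ v i) / W.
  apply/eqP; rewrite eq_sym subr_eq -{1}p1 (bigID (B s)) /= mulr_suml.
  rewrite big_mkcond; apply/eqP; congr (_ + _); apply: eq_bigr => i _.
  rewrite indicE /B; case: ifPn => Bi; first by rewrite mem_set ?mulr1.
  by rewrite memNset ?mulr0 //; exact/negP.
(* Success on the weighted law is thus exactly the weak hypothesis of [boosting]. *)
have covP (s : U) : ((1 - eps0)%:E <= D (xsection C (subsample S idx, s)))%E <->
    \sum_(i | ~~ B s i) 2 ^+ v i <= eps0 * W.
  by rewrite CE DE lee_fin covE lerD2l lerN2 ler_pdivrMr.
by apply/seteqP; split=> s; rewrite /xsection /= inE /= => /covP.
Qed.

(** If every [v] has a seed in [G v], [boosting] produces fitting runs. All [N] independent seeds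
    miss a given [G v] with probability at most [delta0 ^+ N], and there are [T.+1 ^ n] vectors
    [v]. *)
Lemma no_fit_le (H : set (X -> Y)) (eps0 delta0 : R) n N T (S : n.-tuple Z)
    (h : X -> Y) :
  0 <= eps0 -> 0 <= delta0 <= 1 ->
  (forall D : probability Z R, realizable H D -> succeeds A D m0 eps0 delta0) ->
  H h -> (forall i, h (tnth S i).1 = (tnth S i).2) -> (0 < n)%N ->
  (forall m : nat, 2 * eps0 * T%:R < m%:R -> n%:R * (1 + eps0) ^+ T < 2 ^+ m) ->
  (iid P N [set s | ~ exists c : {ffun 'I_T -> run n N},
      fits (1 - 2 * eps0) c (S, s)] <= ((T.+1 ^ n)%:R * delta0 ^+ N)%:E)%E.
Proof.
move=> eps00 /andP[d0 d1] hA Hh hS n0 large.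
pose cov (r : run n N) (s : N.-tuple U) i :=
  (tnth S i).2 \in run_list r (S, s) (tnth S i).1.
have [idx idxP] := choice (fun v : {ffun 'I_n -> 'I_T.+1} => good_run v hA Hh hS n0).
pose G v := [set s : U | \sum_(i | (tnth S i).2 \notin
      output (subsample S (idx v)) s (tnth S i).1) 2 ^+ v i <=
    eps0 * \sum_i 2 ^+ v i :> R].
have mG v : measurable (G v).
  pose B i := [set s : U | (tnth S i).2 \in
    output (subsample S (idx v)) s (tnth S i).1].
  have mB i : measurable (B i).
    pose L (s : U) := output (subsample S (idx v)) s (tnth S i).1.
    apply: (@measurable_mem _ _ mdiagY _ _ _ L); last exact: measurable_cst.
    pose f (p : (m0.-tuple Z * U) * X) := output p.1.1 p.1.2 p.2.
    have mf : measurable_fun setT f := @measurable_output _ _ _ _ _ _ A m0.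
    apply: (measurableT_comp (g := fun s : U =>
      ((subsample S (idx v), s), (tnth S i).1)) mf).
    by apply: measurable_fun_pair => //; exact: measurable_fun_pair.
  have := @measurable_pattern _ _ _ B (fun b => \sum_(i | ~~ b i) 2 ^+ v i <=
    eps0 * \sum_i 2 ^+ v i :> R) mB.
  have e s : \sum_(i | ~~ [ffun i => `[< B i s >]] i) 2 ^+ v i =
      \sum_(i | (tnth S i).2 \notin
        output (subsample S (idx v)) s (tnth S i).1) 2 ^+ v i :> R.
    by apply: eq_bigl => i; rewrite ffunE asboolb.
  by congr measurable; apply/seteqP; split=> s; rewrite /G /= e.
pose F v := [set s : N.-tuple U | forall j, (~` G v) (tnth s j)].
have mF v : measurable (F v).
  apply: (@measurable_forall _ _ _ (fun j => [set s | (~` G v) (tnth s j)])) => j.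
  by apply: measurable_tnth_preimage; exact: measurableC.
have card_v : #|{ffun 'I_n -> 'I_T.+1}| = (T.+1 ^ n)%N.
  by rewrite card_ffun !card_ord.
rewrite -card_v; apply: (union_bound (F := F)) => //.
- rewrite (_ : mkset _ = ~` [set s | exists c : {ffun 'I_T -> run n N},
    fits (1 - 2 * eps0) c (S, s)]) //.
  apply: measurableC.
  apply: (@measurable_exists _ _ _ (fun c : {ffun 'I_T -> run n N} =>
    [set s | fits (1 - 2 * eps0) c (S, s)])) => c.
  rewrite (_ : mkset _ = xsection (fits (1 - 2 * eps0) c) S).
    by apply: measurable_xsection; exact: measurable_fits.
  by apply/seteqP; split=> s; rewrite /xsection /= inE.
- move=> s nofit; apply: contrapT => /forallNP nF; apply: nofit.
  have [|c cP] := @boosting R n T _ (fun r => cov r s) eps0 eps00 _ large.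
    move=> v; have /existsNP[j /contrapT Gj] := nF v.
    by exists (idx v, j).
  by exists c.
move=> v.
have mGC : measurable (~` G v) by exact: measurableC.
have PGC : (P (~` G v) <= delta0%:E)%E.
  have := idxP v; rewrite -/(G v) probability_setC // EFinB.
  by rewrite -(@fineK _ (P (G v))) ?fin_num_measure // -!EFinB !lee_fin; lra.
have PGE : P (~` G v) = (fine (P (~` G v)))%:E by rewrite fineK ?fin_num_measure.
rewrite (iid_all N mGC PGE) lee_fin lerXn2r ?nnegrE ?fine_ge0 //.
by rewrite -lee_fin -PGE.
Qed.

(** Once the seeds are fixed, the lists depend on at most [m0 * T] sample points, and [overfit_le]
    applies with the others as test points. *)
Lemma fits_overfit_le (D : probability Z R) (theta a : R) n N T
    (c : {ffun 'I_T -> run n N}) : 0 <= a <= 1 ->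
  ((iid D n \x iid P N) [set w | fits theta c w /\
      D [set z | heavy theta (run_lists c w z.1) z.2] <= a%:E] <=
    (a ^+ (n - m0 * T))%:E)%E.
Proof.
move=> /andP[a0 a1].
pose E := [set p : (n.-tuple Z * N.-tuple U) * Z |
  heavy theta (run_lists c p.1 p.2.1) p.2.2].
have mE : measurable E by exact: measurable_run_heavy.
have EE w : xsection E w = [set z | heavy theta (run_lists c w z.1) z.2].
  by apply/seteqP; split=> z; rewrite /xsection /= inE.
pose I := [pred i | i \in codom (fun p : 'I_T * 'I_m0 => (c p.1).1 p.2)].
(* Repeated positions only add test points, which is harmless as [a <= 1]. *)
have cardI : (n - m0 * T <= \sum_(i < n) ~~ I i)%N.
  have -> : (\sum_(i < n) ~~ I i = #|[predC I]|)%N.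
    rewrite -sum1_card [RHS]big_mkcond; apply: eq_bigr => i _.
    by rewrite !inE; case: (i \in _).
  rewrite leq_subLR -[X in (X <= _)%N](card_ord n) -(cardC I) leq_add2r.
  rewrite (leq_trans (card_size _)) // size_codom card_prod !card_ord.
  by rewrite mulnC.
have mF : measurable [set w | fits theta c w /\
    D [set z | heavy theta (run_lists c w z.1) z.2] <= a%:E]%E.
  apply: measurableI; first exact: measurable_fits.
  have := measurable_section_le D a%:E mE.
  by congr measurable; apply/seteqP; split=> w /=; rewrite EE.
apply: product_probability_le_r => // s.
pose Es := [set q : n.-tuple Z * Z | E ((q.1, s), q.2)].
have mEs : measurable Es.
  rewrite (_ : Es = (fun q => ((q.1, s), q.2)) @^-1` E) //.
  rewrite -[X in measurable X]setTI.
  apply: (_ : measurable_fun setT _) => //.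
  by apply: measurable_fun_pair => //; exact: measurable_fun_pair.
apply: (@le_trans _ _ (a ^+ (\sum_(i < n) ~~ I i))%:E); last first.
  by rewrite lee_fin ler_wiXn2l.
apply: (@le_trans _ _ (iid D n (overfit D a I Es))); last first.
  apply: overfit_le => // S S' z SS'; rewrite /Es /E /= /heavy.
  suff -> : run_lists c (S, s) z.1 = run_lists c (S', s) z.1 by [].
  apply/funext => t; rewrite /run_lists /run_list /=; congr (output _ _ _).
  apply: eq_from_tnth => j; rewrite !tnth_mktuple; apply: SS'.
  by rewrite inE; apply/codomP; exists (t, j).
apply: le_measure; rewrite ?inE.
- exact: measurable_ysection.
- exact: measurable_overfit.
move=> S; rewrite /ysection /= inE /= => -[fS DS]; split.
  by rewrite (_ : xsection Es S = [set z | heavy theta (run_lists c (S, s) z.1) z.2]) //;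
    apply/seteqP; split=> z; rewrite /xsection /= inE.
by move=> i _; exact: fS.
Qed.

(** The infimum in [realizable] need not be attained, so [h] is chosen for the given [n] and
    [delta], with error small enough for Bernoulli's inequality to conclude. *)
Lemma inconsistent_le (H : set (X -> Y)) (D : probability Z R) (delta : R) n :
  (forall h, H h -> measurable [set z : Z | h z.1 <> z.2]) ->
  realizable H D -> 0 < delta ->
  exists2 h, H h & (iid D n
    (~` [set S | forall i, h (tnth S i).1 = (tnth S i).2]) <= delta%:E)%E.
Proof.
move=> mH Dreal delta0.
(* Dividing by [n.+1] keeps the threshold meaningful for the empty sample. *)
have e0 : 0 < delta / n.+1%:R by rewrite divr_gt0.
have [|_ [h Hh <-] Dh] := @ereal_inf_lt _ [set D [set z | h z.1 <> z.2] | h in H]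
    (delta / n.+1%:R)%:E; first by rewrite [ereal_inf _]Dreal lte_fin.
exists h => //.
set err := [set z : Z | h z.1 <> z.2] in Dh.
have merr : measurable err by exact: mH.
have mC : measurable (~` err) by exact: measurableC.
pose b := fine (D (~` err)).
have Db : D (~` err) = b%:E by rewrite fineK ?fin_num_measure.
have b0 : 0 <= b by rewrite fine_ge0.
have b1 : b <= 1 by rewrite -lee_fin -Db probability_le1.
have be : 1 - b <= delta / n.+1%:R.
  move: Dh; have := probability_setC D mC; rewrite setCK Db => ->.
  by rewrite -EFinB lte_fin => /ltW.
have bern k : 1 - b ^+ k <= k%:R * (1 - b).
  elim: k => [|k IH]; first by rewrite expr0 subrr mul0r.
  have bk : b * (1 - b ^+ k) <= 1 - b ^+ k.
    by rewrite ler_piMl // subr_ge0 exprn_ile1.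
  by rewrite exprS -natr1; lra.
rewrite (_ : [set S | _] = [set S | forall i, (~` err) (tnth S i)]); last first.
  apply/seteqP; split=> S /= hS i; have := hS i; rewrite /err /=; first by move=> ->.
  by move/contrapT.
rewrite probability_setC; last first.
  by apply: measurable_forall => i; exact: measurable_tnth_preimage.
rewrite (iid_all n mC Db) -EFinB lee_fin (le_trans (bern n)) //.
rewrite (le_trans (ler_wpM2l _ be)) // mulrCA ler_piMr ?(ltW delta0) //.
by rewrite ler_pdivrMr // mul1r ler_nat.
Qed.

(** Failure is split into three events of probability at most [delta / 3]: the sample disagrees with
    [h]; it agrees but no choice of runs fits it; some fitting choice generalizes badly. The last is
    taken over all choices, since the one behind [g] depends on the data. *)
Lemma boosted_success (H : set (X -> Y)) (D : probability Z R)
    (eps0 delta0 eps delta : R) n N T k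
    (g : n.-tuple Z * N.-tuple U -> X -> k.-tuple Y) :
  (forall h, H h -> measurable [set z : Z | h z.1 <> z.2]) ->
  (forall D : probability Z R, realizable H D -> succeeds A D m0 eps0 delta0) ->
  realizable H D -> 0 <= eps0 -> 0 <= delta0 <= 1 -> 0 < eps -> 0 < delta ->
  (0 < n)%N ->
  (forall m : nat, 2 * eps0 * T%:R < m%:R -> n%:R * (1 + eps0) ^+ T < 2 ^+ m) ->
  (T.+1 ^ n)%:R * delta0 ^+ N <= delta / 3 ->
  ((n ^ m0 * N) ^ T)%:R * expR (- eps) ^+ (n - m0 * T) <= delta / 3 ->
  measurable_fun setT (fun p : (n.-tuple Z * N.-tuple U) * X => g p.1 p.2) ->
  (forall w, (exists c : {ffun 'I_T -> run n N}, fits (1 - 2 * eps0) c w) ->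
    exists c : {ffun 'I_T -> run n N}, fits (1 - 2 * eps0) c w /\
      forall x y, heavy (1 - 2 * eps0) (run_lists c w x) y -> y \in g w x) ->
  ((1 - delta)%:E <= (iid D n \x iid P N)
    [set w | (1 - eps)%:E <= D [set z | z.2 \in g w z.1]])%E.
Proof.
move=> mH hA Dreal eps0_ge0 delta0_01 eps_gt0 delta_gt0 n_gt0 large.
move=> few_seeds few_runs mg gP; set theta := 1 - 2 * eps0.
have d3 : 0 < delta / 3 by rewrite divr_gt0.
have [h Hh incons] := inconsistent_le n mH Dreal d3.
set cons := [set S : n.-tuple Z | forall i, h (tnth S i).1 = (tnth S i).2] in incons.
have mcons : measurable cons.
  rewrite (_ : cons = [set S | forall i, (~` [set z | h z.1 <> z.2]) (tnth S i)]).
    apply: measurable_forall => i; apply: measurable_tnth_preimage.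
    by apply: measurableC; exact: mH.
  apply/seteqP; split=> S /= hS i; have := hS i; first by move=> ->.
  by move/contrapT.
pose fittable := [set w | exists c : {ffun 'I_T -> run n N}, fits theta c w].
have mfit : measurable fittable.
  by apply: measurable_exists => c; exact: measurable_fits.
(* As [1 - eps <= expR (- eps)], a coverage below [1 - eps] is at most [a]. *)
pose a := expR (- eps).
have a01 : 0 <= a <= 1 by rewrite expR_ge0 expR_le1 oppr_le0 ltW.
pose heavyset (c : {ffun 'I_T -> run n N}) w :=
  [set z : Z | heavy theta (run_lists c w z.1) z.2].
pose O (c : {ffun 'I_T -> run n N}) :=
  [set w | fits theta c w /\ D (heavyset c w) <= a%:E]%E.
have hsE c w : xsection [set p : (n.-tuple Z * N.-tuple U) * Z |
    heavy theta (run_lists c p.1 p.2.1) p.2.2] w = heavyset c w.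
  by apply/seteqP; split=> z; rewrite /xsection /= inE.
have mheavy c w : measurable (heavyset c w).
  by rewrite -hsE; apply: measurable_xsection; exact: measurable_run_heavy.
have mO c : measurable (O c).
  apply: measurableI; first exact: measurable_fits.
  have := measurable_section_le D a%:E (measurable_run_heavy theta c).
  by congr measurable; apply/seteqP; split=> w /=; rewrite hsE.
pose C := [set p : (n.-tuple Z * N.-tuple U) * Z | p.2.2 \in g p.1 p.2.1].
have mC : measurable C.
  pose L (p : (n.-tuple Z * N.-tuple U) * Z) := g p.1 p.2.1.
  apply: (@measurable_mem _ _ mdiagY _ _ _ L); last exact: measurableT_comp.
  apply: (measurableT_comp
    (g := fun p : (n.-tuple Z * N.-tuple U) * Z => (p.1, p.2.1)) mg).
  by apply: measurable_fun_pair => //; exact: measurableT_comp.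
have CE w : xsection C w = [set z | z.2 \in g w z.1].
  by apply/seteqP; split=> z; rewrite /xsection /= inE.
set good := [set w | _].
have mgood : measurable good.
  have := measurable_section_ge D (1 - eps)%:E mC.
  by congr measurable; apply/seteqP; split=> w /=; rewrite CE.
pose Q : probability _ R := (iid D n \x iid P N)%E.
pose F1 := ~` (fst @^-1` cons) : set (n.-tuple Z * N.-tuple U).
pose F2 := (fst @^-1` cons) `&` ~` fittable.
pose F3 := [set w | exists c, O c w].
have mfst : measurable (fst @^-1` cons : set (n.-tuple Z * N.-tuple U)).
  by rewrite -[X in measurable X]setTI; exact: measurable_fst.
have mF1 : measurable F1 by exact: measurableC.
have mF2 : measurable F2 by apply: measurableI => //; exact: measurableC.
have mF3 : measurable F3 by exact: measurable_exists.
have QF1 : (Q F1 <= (delta / 3)%:E)%E.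
  apply: product_probability_le_r => // s.
  rewrite (_ : ysection F1 s = ~` cons) //.
  by apply/seteqP; split=> S; rewrite /ysection /= inE.
have QF2 : (Q F2 <= (delta / 3)%:E)%E.
  apply: product_probability_le => // S.
  have [cS|ncS] := pselect (cons S); last first.
    rewrite (_ : xsection F2 S = set0) ?measure0 ?lee_fin ?(ltW d3) //.
    by rewrite -subset0 => s; rewrite /xsection /= inE => -[].
  apply: (@le_trans _ _ ((T.+1 ^ n)%:R * delta0 ^+ N)%:E); last by rewrite lee_fin.
  apply: le_trans (no_fit_le N eps0_ge0 delta0_01 hA Hh cS n_gt0 large).
  rewrite le_eqVlt; apply/orP; left; apply/eqP; congr (iid P N _).
  by apply/seteqP; split=> s; rewrite /xsection /= inE; [case|].
have QF3 : (Q F3 <= (delta / 3)%:E)%E.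
  have card_runs : #|{ffun 'I_T -> run n N}| = ((n ^ m0 * N) ^ T)%N.
    by rewrite card_ffun card_prod card_ffun !card_ord.
  apply: (@le_trans _ _ (((n ^ m0 * N) ^ T)%:R * a ^+ (n - m0 * T))%:E); last first.
    by rewrite lee_fin.
  rewrite -card_runs; apply: (union_bound (F := O)) => // c.
  exact: fits_overfit_le.
have bad : ~` good `<=` F1 `|` (F2 `|` F3).
  move=> w ngood.
  have [cw|ncw] := pselect (cons w.1); last by left.
  have [fw|nfw] := pselect (fittable w); last by right; left.
  right; right; have [c [fc gc]] := gP w fw; exists c; split=> //.
  apply: (@le_trans _ _ (D (xsection C w))).
    apply: le_measure; rewrite ?inE //; first exact: measurable_xsection.
    by move=> z hz; rewrite /xsection /= inE; exact: gc.
  rewrite CE; move/negP: ngood; rewrite /good /= -ltNge => /ltW /le_trans; apply.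
  by rewrite lee_fin expR_ge1Dx.
have mbad : measurable (F1 `|` (F2 `|` F3)).
  by apply: measurableU => //; exact: measurableU.
have Qbad : (Q (~` good) <= delta%:E)%E.
  apply: (@le_trans _ _ (Q (F1 `|` (F2 `|` F3)))).
    by apply: le_measure; rewrite ?inE //; exact: measurableC.
  apply: le_trans (measureU2 _ _ _) _ => //; first exact: measurableU.
  have -> : delta%:E = ((delta / 3)%:E + ((delta / 3)%:E + (delta / 3)%:E))%E.
    by rewrite -!EFinD; congr EFin; lra.
  apply: leeD => //; apply: le_trans (measureU2 _ _ _) _ => //.
  exact: leeD.
suff : ((1 - delta)%:E <= Q good)%E by [].
have Qg : Q good = (fine (Q good))%:E by rewrite fineK ?fin_num_measure.
move: Qbad; rewrite probability_setC // Qg -EFinB !lee_fin.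
by rewrite !lerBlDr addrC.
Qed.

End boosted_lists.

Theorem theorem4 (R : realType) (dX dY : measure_display)
    (X : measurableType dX) (Y : measurableType dY)
    (mdiagY : measurable [set p : Y * Y | p.1 = p.2])
    (H : set (X -> Y))
    (mH : forall h, H h -> measurable [set z : X * Y | h z.1 <> z.2])
    (eps0 delta0 : R)
    (heps0 : 0 < eps0 < 2^-1) (hdelta0 : 0 < delta0 < 1)
    (k0 : nat) (hk0 : (0 < k0)%N) (m0 : nat)
    (A : list_algorithm R X Y k0)
    (hA : forall D : probability (X * Y)%type R, realizable H D ->
          forall n : nat, (m0 <= n)%N -> succeeds A D n eps0 delta0) :
  exists B : list_algorithm R X Y (Num.truncn (k0%:R / (1 - 2 * eps0))),
    list_PAC_learner H B.
Proof.
have /andP[e0 e2] := heps0; have /andP[d0 d1] := hdelta0.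
have theta0 : 0 < 1 - 2 * eps0 by lra.
(* [T] is fixed before [eps] and [delta], so a single algorithm serves all accuracies. *)
have [T TP] := sampling_schedule m0 e0 hdelta0.
have ex n := boosted_output mdiagY A m0 n (n ^ 2) (T n) theta0 hk0.
pose g n := projT1 (cid (ex n)).
have gP n := projT2 (cid (ex n)).
have mg n : measurable_fun setT
    (fun p : (n.-tuple (X * Y) * (n ^ 2).-tuple (seed A m0)) * X =>
      g n (p.1.1, p.1.2) p.2).
  have [mgn _] := gP n; rewrite (_ : (fun p => _) = (fun p => g n p.1 p.2)) //.
  by apply/funext => -[[]].
(* At sample size [n] the seed of [B] is a tuple of [n ^ 2] independent seeds of [A], each for
   sample size [m0]. *)
pose B := @ListAlgorithm R dX dY X Y _ _ _ (fun n => iid (seed_law A m0) (n ^ 2))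
  (fun n S s x => g n (S, s) x) mg.
exists B.
(* 0 is a filler for nonpositive parameters; [delta / 3] accounts for the three failure events. *)
pose m eps delta : nat := if pselect (0 < eps /\ 0 < delta / 3) is left h then
  projT1 (cid (TP eps (delta / 3) h.1 h.2)) else 0%N.
exists m => D Dreal eps delta eps_gt0 delta_gt0 n.
rewrite /m; case: pselect => [h|[]]; last by split; rewrite // divr_gt0.
case: cid => n1 /= n1P /n1P[/andP[n_gt0 T_gt0] m0T large few_seeds few_runs].
have [_ /(_ T_gt0) gPn] := gP n.
have d01 : 0 <= delta0 <= 1 by rewrite !ltW.
exact: (boosted_success mdiagY mH (fun D hD => hA D hD m0 (leqnn m0)) Dreal
  (ltW e0) d01 eps_gt0 delta_gt0 n_gt0 large few_seeds few_runs (proj1 (gP n)) gPn).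
Qed.
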